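(* Let $n\ge1$, $\delta_{[1]},\ldots,\delta_{[n]}\in\{0,1\}$, and for $0\le p\le1$ let $$L^c(p)=\max_{0\le F_1\le\cdots\le F_n\le 1-p} L(F_1,\ldots,F_n),\qquad L(F_1,\ldots,F_n)=\sum_{i=1}^n\left(\delta_{[i]}\log F_i+(1-\delta_{[i]})\log(1-F_i)\right).$$ Let $\hat F_i=\max_{h\le i}\min_{k\ge i}\frac{\sum_{j=h}^k\delta_{[j]}}{k-h+1}$, $1\le i\le n$. Then $L^c(p)$ is non-increasing in $0\le p\le1$, and $$\sup_{0\le p\le1}L^c(p)=L(\hat F_1,\ldots,\hat F_n)=L^c(\hat p)\quad\text{for any } 0\le\hat p\le 1-\hat F_n.$$ Hence the maximizer $\hat p$ of $L^c$ over $[0,1]$ (the nonparametric maximum likelihood estimator of the cure-rate) is unique if and only if $1-\hat F_n=0=\hat p$.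
   Context: Setting: Case-1 interval censoring (current status data) with cure-rate $p$. One observes $(\delta_i,Y_i)$, $i=1,\ldots,n$, with $\delta_i=I(X_i\le Y_i)$; $\delta_{[i]}$ is the concomitant of the $i$-th order statistic $Y_{(i)}$ of $Y_1,\ldots,Y_n$. The time-to-event satisfies $P(X\le t)=(1-p)F(t)$ with $F$ a proper distribution function; in the log-likelihood, $F_i$ stands for $(1-p)F(Y_{(i)})$, and $L^c(p)$ is the profile log-likelihood of $p$. In the max-min formula, $1\le h\le i\le k\le n$. Conventions: $0\log 0=0$ and $\log 0=-\infty$. *)

(* Defs.v *)
From mathcomp Require Import all_boot all_order all_algebra.
From mathcomp Require Import all_classical all_reals all_analysis.

Set Implicit Arguments.
Unset Strict Implicit.
Unset Printing Implicit Defensive.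

Import Order.TTheory GRing.Theory Num.Theory.

Local Open Scope classical_set_scope.
Local Open Scope ring_scope.

(* The sample size is n.+1; [delta i] is the concomitant (status) attached to
   the observation of rank [i.+1], so that [ord_max] is the last rank. *)

(* [lne] satisfies lne 0 = -oo, and 0 * x = 0 holds in \bar R for every x, so
   the conventions 0 log 0 = 0 and log 0 = -oo are those of the library. *)
Definition loglik (R : realType) (n : nat) (delta : 'I_n.+1 -> bool)
    (F : 'I_n.+1 -> R) : \bar R :=
  (\sum_(i < n.+1) ((delta i)%:R%:E * lne (F i)%:E
                    + (1 - (delta i)%:R)%:E * lne (1 - F i)%:E))%E.

Definition feasible (R : realType) (n : nat) (p : R) : set ('I_n.+1 -> R) :=
  [set F | [/\ 0 <= F ord0,
               forall i j : 'I_n.+1, (i <= j)%N -> F i <= F j &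
               F ord_max <= 1 - p]].

(* Taken as a supremum; that it is a maximum for 0 <= p <= 1 is to be asserted
   wherever it matters. *)
Definition profile_loglik (R : realType) (n : nat) (delta : 'I_n.+1 -> bool)
    (p : R) : \bar R :=
  ereal_sup [set loglik delta F | F in feasible p].

Definition block_mean (R : realType) (n : nat) (delta : 'I_n.+1 -> bool)
    (h k : 'I_n.+1) : R :=
  (\sum_(j < n.+1 | (h <= j <= k)%N) (delta j)%:R) / (k - h + 1)%N%:R.

(* The default values of the big operators are the terms at k = i and h = i,
   which already belong to the (nonempty) ranges: these are a genuine minimum
   and a genuine maximum. *)
Definition min_mean (R : realType) (n : nat) (delta : 'I_n.+1 -> bool)
    (h i : 'I_n.+1) : R :=
  \big[Num.min/block_mean R delta h i]_(k < n.+1 | (i <= k)%N)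
     block_mean R delta h k.

Definition Fhat (R : realType) (n : nat) (delta : 'I_n.+1 -> bool)
    (i : 'I_n.+1) : R :=
  \big[Num.max/min_mean R delta i i]_(h < n.+1 | (h <= i)%N)
     min_mean R delta h i.

Definition is_profile_maximizer (R : realType) (n : nat)
    (delta : 'I_n.+1 -> bool) (p : R) : Prop :=
  0 <= p <= 1 /\
  forall q : R, 0 <= q <= 1 ->
    (profile_loglik delta q <= profile_loglik delta p)%E.

(* Main.v *)
Require Import Defs.
From mathcomp Require Import all_boot all_order all_algebra.
From mathcomp Require Import all_classical all_reals all_analysis.
From mathcomp Require Import zify ring lra.

Set Implicit Arguments.
Unset Strict Implicit.
Unset Printing Implicit Defensive.

Import Order.TTheory GRing.Theory Num.Theory.
Local Open Scope classical_set_scope.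
Local Open Scope ring_scope.

(** The profile log-likelihood at every p is attained at the max-min estimator
truncated at 1 - p, that is at g_i = min (Fhat_i, 1 - p)
([loglik_le_truncated]).  It is non-increasing because the constraint sets
shrink as p grows, so its supremum is the value at p = 0, where g = Fhat.

Why g is optimal.  The log-likelihood of one observation is concave, so it lies
below its tangent at g_i ([bernoulli_ll_tangent]); summing, a feasible F gains
over g at most
  sum_i (delta_i - g_i) (F_i - g_i) / (g_i (1 - g_i)),
where 1 / 0 = 0: if g_i is 0 or 1 and F_i differs from it, observation i has
probability one under g, and nothing can be gained there.  This score is
non-positive ([score_le0]).  Indeed, write
delta_i - g_i = (delta_i - Fhat_i) + (Fhat_i - g_i).  The second part
contributes only where g_i = 1 - p < Fhat_i, and there F_i <= g_i.  For the
first part, let S_k be the sum of delta_j - Fhat_j over the first k ranks: this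
is the distance from the cumulative sum diagram down to its greatest convex
minorant, so S_k >= 0, with S_k = 0 at both ends and wherever Fhat jumps
([cumulative_residual], derived from the max-min formula).  Abel summation
turns the first part into minus the sum of S_k times the increments of
(F_i - g_i) / (g_i (1 - g_i)); where Fhat does not jump, neither does g, and
that increment is a non-negative multiple of F_(k+1) - F_k.

Uniqueness.  Every p in [0, 1 - Fhat_n] leaves Fhat untouched, hence is a
maximizer.  If Fhat_n = 1, the last delta is 1, and for p > 0 raising the last
value of F from at most 1 - p to 1 strictly increases the log-likelihood,
unless it was -oo, which is not the maximum ([profile_loglik_lt]);
so p = 0 is the only maximizer. *)

(** * The log-likelihood of one observation *)

Definition bernoulli_ll (R : realType) (b : bool) (x : R) : \bar R :=
  (b%:R%:E * lne x%:E + (1 - b%:R)%:E * lne (1 - x)%:E)%E.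

Lemma bernoulli_ll1 (R : realType) (x : R) : bernoulli_ll true x = lne x%:E.
Proof. by rewrite /bernoulli_ll subrr mul1e mul0e adde0. Qed.

Lemma bernoulli_ll0 (R : realType) (x : R) :
  bernoulli_ll false x = lne (1 - x)%:E.
Proof. by rewrite /bernoulli_ll subr0 mul1e mul0e add0e. Qed.

Lemma bernoulli_ll_le0 (R : realType) (b : bool) (x : R) :
  0 <= x <= 1 -> (bernoulli_ll b x <= 0)%E.
Proof.
move=> /andP[x0 x1]; case: b; rewrite (bernoulli_ll1, bernoulli_ll0) lne_le0.
  by rewrite lee_fin.
by rewrite lee_fin gerBl.
Qed.

(** This is log t <= t - 1 at t = x / g.  The slope 1 / g is written as
(1 - g) / (g (1 - g)), the form common to both outcomes; at g = 1 the inverse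
of 0 is 0, and the inequality still holds, as log x <= 0. *)
Lemma lne_tangent (R : realType) (x g : R) : 0 <= x <= 1 -> 0 < g <= 1 ->
  (lne x%:E <= lne g%:E + ((1 - g) * ((x - g) * (g * (1 - g))^-1))%:E)%E.
Proof.
move=> /andP[x0 x1] /andP[g0 g1].
have [->|gN1] := eqVneq g 1.
  by rewrite lne1 add0e subrr mul0r lne_le0 lee_fin.
have [->|xN0] := eqVneq x 0; first by rewrite le0_lneNy// leNye.
have xp : 0 < x by rewrite lt_neqAle eq_sym xN0.
rewrite !lne_EFin// -EFinD lee_fin -lerBlDl -ln_div ?posrE//.
have -> : (1 - g) * ((x - g) * (g * (1 - g))^-1) = x / g - 1.
  by field; rewrite gt_eqF//= subr_eq0 eq_sym.
have -> : x / g = 1 + (x / g - 1) by ring.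
apply: (le_trans (le_ln1Dx _)); last lra.
by rewrite ltrBrDl addrN divr_gt0.
Qed.

(** Concavity, with the derivative (b - g) / (g (1 - g)) of the log-likelihood
at g.  At g = 0 and g = 1 this slope is 0 by the convention on inverses; the
inequality then holds because the value at g is 0, the maximum, unless the
outcome is impossible under g, which the last two hypotheses exclude (at g = 0
an impossible outcome is harmless if x = 0 too). *)
Lemma bernoulli_ll_tangent (R : realType) (b : bool) (x g : R) :
  0 <= x <= 1 -> 0 <= g <= 1 ->
  (g = 0 -> b -> x = 0) -> (g = 1 -> b) ->
  (bernoulli_ll b x
     <= bernoulli_ll b g + ((b%:R - g) * ((x - g) * (g * (1 - g))^-1))%:E)%E.
Proof.
move=> x01 g01 hg0 hg1; have /andP[g0 g1] := g01.
case: b hg0 hg1 => [hg0 _|_ hg1]; rewrite ?bernoulli_ll1 ?bernoulli_ll0.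
  have [gE|gN0] := eqVneq g 0.
    by rewrite hg0// le0_lneNy// leNye.
  by apply: lne_tangent => //; rewrite lt_neqAle eq_sym gN0 g0.
have -> : (false%:R - g) * ((x - g) * (g * (1 - g))^-1) =
  (1 - (1 - g)) * ((1 - x - (1 - g)) * ((1 - g) * (1 - (1 - g)))^-1) :> R.
  have -> : (1 - g) * (1 - (1 - g)) = g * (1 - g) by ring.
  by rewrite !mulrA; congr (_ * _); rewrite mulr0n; ring.
apply: lne_tangent; first by move/andP: x01 => [? ?]; apply/andP; split; lra.
rewrite subr_gt0 lerBlDr lerDl g0 andbT lt_neqAle g1 andbT.
by apply/eqP => /hg1.
Qed.

(** * Finite sums *)

Lemma big_ord_nat_itv (R : nmodType) (n : nat) (F : nat -> R) (h k : nat) :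
  (h <= k < n)%N ->
  \sum_(j < n | (h <= j <= k)%N) F j = \sum_(h <= j < k.+1) F j.
Proof.
move=> /andP[hk kn].
rewrite -(big_mkord (fun j => h <= j <= k)%N F).
rewrite [RHS](big_nat_widen _ _ n)// [RHS](big_nat_widenl _ 0)//.
by apply: eq_bigl => j; rewrite ltnS andbC.
Qed.

Lemma abel_summation (R : comPzRingType) (x u : nat -> R) (N : nat) :
  \sum_(0 <= j < N.+1) x j * u j =
  (\sum_(0 <= j < N.+1) x j) * u N -
  \sum_(0 <= m < N) (\sum_(0 <= j < m.+1) x j) * (u m.+1 - u m).
Proof.
elim: N => [|N IH]; first by rewrite !big_nat1 big_geq// subr0.
rewrite big_nat_recr//= IH.
rewrite [\sum_(0 <= m < N.+1) _ in RHS]big_nat_recr//=.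
rewrite [\sum_(0 <= j < N.+2) x j]big_nat_recr//=; ring.
Qed.

(** * The max-min formula *)

Section MaxMin.
Variables (R : realType) (n : nat) (delta : 'I_n.+1 -> bool).

Local Notation d j := ((delta (inord j))%:R : R).
Local Notation f j := (Fhat R delta (inord j)).

(** The sign of this sum compares v with the mean of the statuses of ranks
h, ..., k - 1; unlike means, these sums add up over adjacent blocks. *)
Definition excess (v : R) (h k : nat) : R := \sum_(h <= j < k) (d j - v).

Lemma excess_cat v h m k : (h <= m <= k)%N ->
  excess v h k = excess v h m + excess v m k.
Proof. by move=> /andP[hm mk]; rewrite /excess (big_cat_nat hm mk). Qed.

Lemma excess_le v w h k : v <= w -> excess w h k <= excess v h k.
Proof. by move=> vw; apply: ler_sum => j _; rewrite lerB. Qed.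

Lemma block_meanE (h k : 'I_n.+1) : (h <= k)%N ->
  block_mean R delta h k = (\sum_(h <= j < k.+1) d j) / (k - h + 1)%N%:R.
Proof.
move=> hk; rewrite /block_mean -(@big_ord_nat_itv _ n.+1) ?hk ?ltn_ord//.
by congr (_ / _); apply: eq_bigr => j _; rewrite inord_val.
Qed.

Lemma excessE v (h k : nat) : (h <= k)%N ->
  excess v h k.+1 = \sum_(h <= j < k.+1) d j - v * (k - h + 1)%N%:R.
Proof.
move=> hk; rewrite /excess sumrB sumr_const_nat mulr_natr.
by rewrite addn1 subSn.
Qed.

Lemma block_mean_le v (h k : 'I_n.+1) : (h <= k)%N ->
  (block_mean R delta h k <= v) = (excess v h k.+1 <= 0).
Proof.
by move=> hk; rewrite block_meanE// excessE// subr_le0 ler_pdivrMr// addn1.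
Qed.

Lemma block_mean_ge v (h k : 'I_n.+1) : (h <= k)%N ->
  (v <= block_mean R delta h k) = (0 <= excess v h k.+1).
Proof.
by move=> hk; rewrite block_meanE// excessE// subr_ge0 ler_pdivlMr// addn1.
Qed.

Lemma min_mean_ge v (h i : 'I_n.+1) : (h <= i)%N ->
  v <= min_mean R delta h i <->
  forall k : 'I_n.+1, (i <= k)%N -> 0 <= excess v h k.+1.
Proof.
move=> hi; split => [/bigmin_geP[_ H] k ik|H].
  by rewrite -block_mean_ge ?(leq_trans hi ik)//; exact: H.
apply/bigmin_geP; split; first by rewrite block_mean_ge// H.
by move=> k ik; rewrite block_mean_ge ?(leq_trans hi ik)// H.
Qed.

Lemma Fhat_ge_min_mean (h i : 'I_n.+1) : (h <= i)%N ->
  min_mean R delta h i <= Fhat R delta i.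
Proof.
by move=> hi; apply: (le_bigmax_cond _ (fun h => min_mean R delta h i)).
Qed.

Lemma Fhat_attained (i : 'I_n.+1) :
  exists2 h : 'I_n.+1, (h <= i)%N & Fhat R delta i = min_mean R delta h i.
Proof.
rewrite /Fhat; elim/big_rec: _ => [|h x hi [h' h'i ->]]; first by exists i.
by rewrite maxEle; case: ifP => _; [exists h'|exists h].
Qed.

Lemma min_mean_attained (h i : 'I_n.+1) :
  exists2 k : 'I_n.+1, (i <= k)%N &
    min_mean R delta h i = block_mean R delta h k.
Proof.
rewrite /min_mean; elim/big_rec: _ => [|k x ik [k' ik' ->]]; first by exists i.
by rewrite minEle; case: ifP => _; [exists k|exists k'].
Qed.

(** The two halves of the max-min formula: any start h of a block gives some
block ending at k >= i with mean at most Fhat_i, ... *)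
Lemma Fhat_right_block (h i : 'I_n.+1) : (h <= i)%N ->
  exists2 k : 'I_n.+1, (i <= k)%N & excess (Fhat R delta i) h k.+1 <= 0.
Proof.
move=> hi; have [k ik E] := min_mean_attained h i; exists k => //.
by rewrite -block_mean_le ?(leq_trans hi ik)// -E Fhat_ge_min_mean.
Qed.

(** ... while for the best start h every such block has mean at least Fhat_i. *)
Lemma Fhat_left_block (i : 'I_n.+1) :
  exists2 h : 'I_n.+1, (h <= i)%N &
    forall k : 'I_n.+1, (i <= k)%N -> 0 <= excess (Fhat R delta i) h k.+1.
Proof.
have [h hi E] := Fhat_attained i; exists h => //.
by apply/min_mean_ge => //; rewrite E.
Qed.

Lemma Fhat_ge v (h i : 'I_n.+1) : (h <= i)%N ->
  (forall k : 'I_n.+1, (i <= k)%N -> 0 <= excess v h k.+1) ->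
  v <= Fhat R delta i.
Proof.
by move=> hi H; apply: le_trans (Fhat_ge_min_mean hi); apply/min_mean_ge.
Qed.

Lemma Fhat_mono (i j : 'I_n.+1) : (i <= j)%N ->
  Fhat R delta i <= Fhat R delta j.
Proof.
move=> ij; have [h hi H] := Fhat_left_block i.
apply: (@Fhat_ge _ h); first exact: leq_trans ij.
by move=> k jk; apply: H; exact: leq_trans jk.
Qed.

Lemma Fhat_ge0 (i : 'I_n.+1) : 0 <= Fhat R delta i.
Proof.
apply: (@Fhat_ge _ i) => // k ik.
by apply: sumr_ge0 => j _; rewrite subr0 ler0n.
Qed.

Lemma Fhat_le1 (i : 'I_n.+1) : Fhat R delta i <= 1.
Proof.
have [h hi H] := Fhat_left_block i; have := H i (leqnn i).
rewrite -block_mean_ge// => /le_trans; apply; rewrite block_mean_le//.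
by apply: sumr_le0 => j _; case: delta; rewrite ?subrr// sub0r oppr_le0.
Qed.

(** Some block that starts at i has mean at most Fhat_i = 0, so all its statuses
are 0.  With [Fhat_eq1]: no observation is impossible under Fhat. *)
Lemma Fhat_eq0 (i : 'I_n.+1) : Fhat R delta i = 0 -> delta i = false.
Proof.
move=> fi; have [k ik] := Fhat_right_block (leqnn i); rewrite fi => H.
apply/negP => di; move: H; apply/negP; rewrite -ltNge /excess big_ltn ?ltnS//.
by rewrite inord_val di subr0 ltr_wpDr// sumr_ge0.
Qed.

Lemma Fhat_eq1 (i : 'I_n.+1) : Fhat R delta i = 1 -> delta i.
Proof.
move=> fi; have [h hi] := Fhat_left_block i; rewrite fi => /(_ i (leqnn i)) H.
apply/negP => /negP di; move: H; apply/negP; rewrite -ltNge /excess.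
rewrite big_nat_recr//= inord_val (negbTE di) sub0r subr_lt0.
apply: le_lt_trans ltr01; apply: sumr_le0 => j _.
by case: delta; rewrite ?subrr// sub0r oppr_le0.
Qed.

(** * The greatest convex minorant of the cumulative sums *)

(** Blocks that start where Fhat jumps past v have means at least v.  Let h be
the best start for rank m.  If h < m, the ranks h, ..., m - 1 have mean below v,
for otherwise Fhat would already have reached v at rank m - 1; as the blocks
from h past m have mean at least v, so does their part from m on. *)
Lemma excess_head_ge0 v (m k : nat) : (m <= k <= n)%N -> v <= f m ->
  (m = 0%N \/ f m.-1 < v) -> 0 <= excess v m k.+1.
Proof.
move=> /andP[mk kn] vf jump; have mn := leq_trans mk kn.
have [h hm H] := Fhat_left_block (inord m).
rewrite inordK ?ltnS// in hm H.
have {}H l : (m <= l <= n)%N -> 0 <= excess v h l.+1.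
  move=> /andP[ml ln]; apply: le_trans (excess_le _ _ vf).
  by have := H (inord l); rewrite inordK ?ltnS//; apply.
case: (ltngtP h m) hm => // [hm' _|hE _]; last first.
  by rewrite -hE; apply: H; rewrite mk.
case: jump => [m0|jump]; first by rewrite m0 in hm'.
have neg : excess v h m < 0.
  rewrite ltNge; apply/negP => pos; move: jump; apply/negP; rewrite -leNgt.
  have m1n : (m.-1 < n.+1)%N by lia.
  apply: (@Fhat_ge _ h); first by rewrite inordK//; lia.
  move=> l; rewrite inordK// => ml.
  have [lm|lm] := ltnP l m; last by apply: H; rewrite lm -ltnS ltn_ord.
  by have -> : l.+1 = m by lia.
have := H k; rewrite (@excess_cat _ _ m) ?mk//; last lia.
by move=> /(_ kn) ?; lra.
Qed.

(** Blocks that end at rank m, right before a jump of Fhat, have means at most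
Fhat_m: some block from i to some k >= m has such a mean, and its part past
the jump has a larger one by [excess_head_ge0]. *)
Lemma excess_tail_le0 (i m : nat) : (i <= m <= n)%N ->
  (m = n \/ f m < f m.+1) -> excess (f m) i m.+1 <= 0.
Proof.
move=> /andP[im mn] jump.
have im' : ((inord i : 'I_n.+1) <= (inord m : 'I_n.+1))%N.
  by rewrite !inordK ?ltnS//; lia.
have [k] := Fhat_right_block im'.
rewrite !inordK ?ltnS//; last lia.
have kn := ltn_ord k.
case: ltngtP => // [mk _ H|-> _//].
case: jump => [?|jump]; first lia.
have := @excess_head_ge0 (f m.+1) m.+1 k; rewrite mk -ltnS kn lexx.
move=> /(_ isT isT (or_intror jump)) H2.
have H3 := excess_le m.+1 k.+1 (ltW jump).
by rewrite (@excess_cat _ _ m.+1) in H; [lra|lia].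
Qed.

(** Induction along the level blocks of Fhat: the sum vanishes up to the start a
of the block of the last rank, and on that block it is an excess over a
constant, whose sign is known after and before jumps. *)
Lemma cumulative_residual (m : nat) : (m <= n.+1)%N ->
  0 <= \sum_(0 <= j < m) (d j - f j) /\
  ((m = n.+1 \/ f m.-1 < f m) -> \sum_(0 <= j < m) (d j - f j) = 0).
Proof.
elim/ltn_ind: m => -[|m] IH mn; first by rewrite big_geq.
rewrite ltnS in mn.
have exP : exists j, (j <= m)%N && (f j == f m) by exists m; rewrite leqnn eqxx.
(* The first rank of the level block of m. *)
pose a := ex_minn exP.
have [am fa amin] : [/\ (a <= m)%N, f a = f m &
    forall j, (j <= m)%N -> f j = f m -> (a <= j)%N].
  rewrite /a; case: ex_minnP => a' /andP[? /eqP ?] H; split=> // j jm fj.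
  by apply: H; rewrite jm fj eqxx.
have jump : a = 0%N \/ f a.-1 < f a.
  have [->|a0] := posnP a; [by left|right].
  rewrite lt_neqAle Fhat_mono ?inordK//; [|lia..].
  rewrite andbT; apply/eqP => E.
  by have := amin a.-1 ltac:(lia) ltac:(congruence); lia.
have Sa : \sum_(0 <= j < a) (d j - f j) = 0.
  case: jump => [->|jump]; first by rewrite big_geq.
  by have [||_] := IH a; [lia..|apply; right].
have SE : \sum_(0 <= j < m.+1) (d j - f j) = excess (f m) a m.+1.
  rewrite (big_cat_nat (leq0n a))//=; last lia.
  rewrite Sa add0r; apply: eq_big_nat => j /andP[aj jm]; congr (_ - _).
  by apply/le_anti; rewrite -{2}fa !Fhat_mono ?inordK//; lia.
have H0 : 0 <= excess (f m) a m.+1.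
  by apply: excess_head_ge0; rewrite -?fa ?am.
rewrite SE; split=> // jump'; apply/le_anti; rewrite H0 andbT.
apply: excess_tail_le0; first by rewrite am.
by case: jump' => [[]|]; [left|right].
Qed.

(** * Optimality of the truncated estimator *)

Definition truncated_Fhat (c : R) (i : 'I_n.+1) : R :=
  Num.min (Fhat R delta i) c.

Local Notation g c i := (truncated_Fhat c i).
Local Notation w x := ((x * (1 - x))^-1).

Lemma truncated_Fhat_itv (c : R) (i : 'I_n.+1) : 0 <= c <= 1 -> 0 <= g c i <= 1.
Proof.
move=> /andP[c0 _]; rewrite le_min Fhat_ge0 c0.
by rewrite (le_trans _ (Fhat_le1 i))// ge_min lexx.
Qed.

Lemma truncated_Fhat_feasible (p : R) : 0 <= p <= 1 ->
  feasible p (truncated_Fhat (1 - p)).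
Proof.
move=> /andP[p0 p1]; split.
- by rewrite le_min Fhat_ge0 subr_ge0.
- move=> i j ij; rewrite le_min ge_min (Fhat_mono ij).
  by rewrite ge_min lexx orbT.
- by rewrite ge_min lexx orbT.
Qed.

Lemma feasible_itv (p : R) F (i : 'I_n.+1) : feasible p F -> 0 <= F i <= 1 - p.
Proof.
move=> [F0 mono Fn]; rewrite (le_trans F0) ?mono//=.
by rewrite (le_trans _ Fn)// mono// -ltnS.
Qed.

Lemma feasible_le (p q : R) F : p <= q -> @feasible R n q F -> feasible p F.
Proof. by move=> pq [F0 mono Fn]; split=> //; apply: le_trans Fn _; lra. Qed.

(** The first-order optimality condition for g = min (Fhat, 1 - p): no feasible
F is an ascent direction from g. *)
Lemma score_le0 (p : R) F : 0 <= p <= 1 -> feasible p F ->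
  \sum_(i < n.+1)
    ((delta i)%:R - g (1 - p) i) *
    ((F i - g (1 - p) i) * w (g (1 - p) i)) <= 0.
Proof.
move=> p01 Fp; set c := 1 - p.
have c01 : 0 <= c <= 1 by move: p01; rewrite /c => /andP[? ?]; apply/andP; lra.
have w0 i : 0 <= w (g c i).
  have /andP[? ?] := truncated_Fhat_itv i c01.
  by rewrite invr_ge0 mulr_ge0// subr_ge0.
pose u (j : nat) := (F (inord j) - g c (inord j)) * w (g c (inord j)).
pose x (j : nat) := d j - f j.
(* Where g differs from Fhat, it is c, which bounds F. *)
have H1 : \sum_(i < n.+1) (Fhat R delta i - g c i) * u i <= 0.
  apply: sumr_le0 => i _; rewrite /u inord_val.
  have /andP[_ Fc] := feasible_itv i Fp.
  have [fc|cf] := leP (Fhat R delta i) c.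
    by rewrite {1}/truncated_Fhat min_l// subrr mul0r.
  have -> : g c i = c by rewrite /truncated_Fhat min_r// ltW.
  rewrite mulr_ge0_le0 ?subr_ge0 ?(ltW cf)// mulr_le0_ge0 ?subr_le0//.
  by have := w0 i; rewrite /truncated_Fhat min_r// ltW.
(* In each Abel term, the partial sum vanishes at a jump of Fhat; elsewhere g
   is constant, and u increases with F. *)
have H2 : \sum_(0 <= j < n.+1) x j * u j <= 0.
  rewrite abel_summation.
  have [_ ->] := cumulative_residual (leqnn n.+1); last by left.
  rewrite mul0r sub0r oppr_le0 big_nat sumr_ge0// => m /andP[_ mn].
  have [S0 jump] := @cumulative_residual m.+1 (ltnW mn).
  have fm : f m <= f m.+1 by rewrite Fhat_mono ?inordK//; lia.
  have [lt|ge] := ltP (f m) (f m.+1); first by rewrite jump ?mul0r//; right.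
  have fE : f m.+1 = f m by apply/le_anti; rewrite ge.
  apply: mulr_ge0 => //; rewrite /u /truncated_Fhat fE -mulrBl.
  apply: mulr_ge0; last exact: w0.
  have [_ mono _] := Fp.
  by rewrite opprB addrA subrK subr_ge0 mono ?inordK//; lia.
rewrite big_mkord in H2.
rewrite (eq_bigr (fun i : 'I_n.+1 =>
    (Fhat R delta i - g c i) * u i + x i * u i)).
  by rewrite big_split/= -[leRHS]addr0 lerD.
by move=> i _; rewrite /x /u inord_val -mulrDl; congr (_ * _); ring.
Qed.

Lemma loglik_le_truncated (p : R) F : 0 <= p <= 1 -> feasible p F ->
  (loglik delta F <= loglik delta (truncated_Fhat (1 - p)))%E.
Proof.
move=> p01 Fp; set c := 1 - p.
have c01 : 0 <= c <= 1 by move: p01; rewrite /c => /andP[? ?]; apply/andP; lra.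
pose r i := ((delta i)%:R - g c i) * ((F i - g c i) * w (g c i)).
apply: (@le_trans _ _
  (\sum_(i < n.+1) (bernoulli_ll (delta i) (g c i) + (r i)%:E))%E).
  apply: lee_sum => i _; have /andP[F0 Fc] := feasible_itv i Fp.
  apply: bernoulli_ll_tangent.
  - by rewrite F0 (le_trans Fc)//; case/andP: c01.
  - exact: truncated_Fhat_itv.
  - rewrite /truncated_Fhat; case: leP => [_ /Fhat_eq0 -> //|_ c0 _].
    by apply/le_anti; rewrite F0 -c0 Fc.
  - move=> g1; apply: Fhat_eq1; apply/le_anti; rewrite Fhat_le1/=.
    by rewrite -g1 ge_min lexx.
rewrite big_split/= sumEFin -[leRHS]adde0 leeD2l// lee_fin.
exact: score_le0.
Qed.

(** * The profile log-likelihood *)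

Lemma profile_loglikE (p : R) : 0 <= p <= 1 ->
  profile_loglik delta p = loglik delta (truncated_Fhat (1 - p)).
Proof.
move=> p01; apply/le_anti/andP; split.
  by apply: ge_ereal_sup => _ [F Fp <-]; exact: loglik_le_truncated.
by apply: ereal_sup_ubound; exists (truncated_Fhat (1 - p)) => //;
  exact: truncated_Fhat_feasible.
Qed.

Lemma profile_loglik_nonincreasing (p q : R) : p <= q ->
  (profile_loglik delta q <= profile_loglik delta p)%E.
Proof.
move=> pq; apply: ereal_sup_le => _ [F Fq <-].
by exists F => //; exact: feasible_le Fq.
Qed.

Lemma profile_loglik_Fhat (p : R) : 0 <= p <= 1 - Fhat R delta ord_max ->
  profile_loglik delta p = loglik delta (Fhat R delta).
Proof.
move=> /andP[p0 pF]; have Fn0 := Fhat_ge0 ord_max.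
rewrite profile_loglikE; last by apply/andP; lra.
congr loglik; apply/funext => i; rewrite /truncated_Fhat min_l//.
have : Fhat R delta i <= Fhat R delta ord_max by rewrite Fhat_mono// -ltnS.
by lra.
Qed.

Lemma profile_loglik0 : profile_loglik delta 0 = loglik delta (Fhat R delta).
Proof. by apply: profile_loglik_Fhat; rewrite lexx subr_ge0 Fhat_le1. Qed.

(** The constant 1/2 is feasible for p = 0 and has a finite log-likelihood. *)
Lemma loglik_Fhat_gtNy : (-oo < loglik delta (Fhat R delta))%E.
Proof.
rewrite -profile_loglik0.
apply: (@lt_le_trans _ _ (loglik delta (fun=> 2^-1 : R))).
  suff : loglik delta (fun=> 2^-1 : R) \is a fin_num.
    by rewrite fin_numElt => /andP[].
  apply/sum_fin_numP => i _ _; rewrite -[X in X \is a _]/(bernoulli_ll _ _).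
  by case: (delta i); rewrite (bernoulli_ll1, bernoulli_ll0) lne_EFin//; lra.
apply: ereal_sup_ubound; exists (fun=> 2^-1) => //.
by split => //; rewrite ?invr_ge0//; lra.
Qed.

(** Let A be the log-likelihood of the optimal G for p without its last term,
which is log G_n < 0.  Replacing G_n by 1 is feasible for p = 0, so A is at most
the log-likelihood of Fhat; if A is finite, log G_n + A < A, and if A is -oo,
the log-likelihood of Fhat is larger because it is finite. *)
Lemma profile_loglik_lt (p : R) : Fhat R delta ord_max = 1 -> 0 < p <= 1 ->
  (profile_loglik delta p < loglik delta (Fhat R delta))%E.
Proof.
move=> Fn1 /andP[p0 p1]; rewrite profile_loglikE; last by rewrite ltW.
set G := truncated_Fhat (1 - p).
have Gp : feasible p G by apply: truncated_Fhat_feasible; rewrite ltW.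
pose G1 i := if i == ord_max then 1 else G i.
have G1f : @feasible R n 0 G1.
  have Gle i : 0 <= G i <= 1.
    by have /andP[? ?] := feasible_itv i Gp; apply/andP; lra.
  split; rewrite /G1.
  - by case: ifP => // _; have /andP[] := Gle ord0.
  - move=> i j ij; case: (j =P ord_max) => [_|/eqP jn].
      by case: ifP => // _; have /andP[] := Gle i.
    rewrite ifN; first by have [_ + _] := Gp; apply.
    apply: contra_neq jn => i_max; apply/val_inj/anti_leq.
    by rewrite -ltnS ltn_ord/= (leq_trans _ ij)// i_max.
  - by rewrite eqxx subr0.
have dn : delta ord_max by exact: Fhat_eq1 Fn1.
set A := (\sum_(i < n.+1 | i != ord_max) bernoulli_ll (delta i) (G i))%E.
have GE : loglik delta G = (lne (G ord_max)%:E + A)%E.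
  by rewrite /loglik (bigD1 ord_max)//= -/(bernoulli_ll _ _) dn bernoulli_ll1.
have G1E : loglik delta G1 = A.
  rewrite /loglik (bigD1 ord_max)//= -/(bernoulli_ll _ _) dn bernoulli_ll1.
  rewrite /G1 eqxx lne1 add0e; apply: eq_bigr => i /negbTE in_.
  by rewrite in_.
have AF : (A <= loglik delta (Fhat R delta))%E.
  by rewrite -G1E -profile_loglik0; apply: ereal_sup_ubound; exists G1.
have A0 : (A <= 0)%E.
  apply: sume_le0 => i _; apply: bernoulli_ll_le0.
  by have /andP[? ?] := feasible_itv i Gp; apply/andP; lra.
have l0 : (lne (G ord_max)%:E < 0)%E.
  by rewrite lne_lt0 lte_fin; have /andP[_ ?] := feasible_itv ord_max Gp; lra.
rewrite GE; have FNy := loglik_Fhat_gtNy.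
case: A A0 AF {GE G1E} => [a| |]// _ AF.
  apply: lt_le_trans AF; rewrite -[ltRHS]add0e lteD2rE//.
by rewrite addeNy.
Qed.

End MaxMin.

Theorem mainTheorem2 (R : realType) (n : nat) (delta : 'I_n.+1 -> bool) :
  [/\
      forall p : R, 0 <= p <= 1 ->
        exists2 F : 'I_n.+1 -> R,
          feasible p F & loglik delta F = profile_loglik delta p,
      forall p q : R, 0 <= p -> p <= q -> q <= 1 ->
        (profile_loglik delta q <= profile_loglik delta p)%E,
      ereal_sup [set profile_loglik delta p | p in [set p : R | 0 <= p <= 1]]
        = loglik delta (Fhat R delta),
      forall phat : R, 0 <= phat <= 1 - Fhat R delta ord_max ->
        loglik delta (Fhat R delta) = profile_loglik delta phat &
      forall phat : R,
        unique (is_profile_maximizer delta) phat <->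
        (1 - Fhat R delta ord_max = 0 /\ 0 = phat)].
Proof.
have Fn1 := Fhat_le1 R delta ord_max; have Fn0 := Fhat_ge0 R delta ord_max.
have max0 q : 0 <= q <= 1 ->
    (profile_loglik delta q <= loglik delta (Fhat R delta))%E.
  move=> /andP[q0 _]; rewrite -profile_loglik0.
  exact: profile_loglik_nonincreasing.
have maxP p : 0 <= p <= 1 - Fhat R delta ord_max ->
    is_profile_maximizer delta p.
  move=> pF; split; first by move/andP: pF => [? ?]; apply/andP; lra.
  by move=> q q01; rewrite (profile_loglik_Fhat pF) max0.
split.
- move=> p p01; exists (truncated_Fhat delta (1 - p)).
    exact: truncated_Fhat_feasible.
  by rewrite profile_loglikE.
- by move=> p q _ pq _; exact: profile_loglik_nonincreasing.
- apply/le_anti/andP; split.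
    by apply: ge_ereal_sup => _ [q q01 <-]; exact: max0.
  apply: ereal_sup_ubound; exists 0; first by rewrite /= lexx ler01.
  exact: profile_loglik0.
- by move=> phat /profile_loglik_Fhat.
- move=> phat; split => [[_ uniq_phat]|[Fn <-]].
    have E0 : phat = 0 by apply/uniq_phat/maxP; rewrite lexx subr_ge0.
    split=> //; rewrite -E0; apply/esym/uniq_phat/maxP.
    by rewrite lexx subr_ge0 Fn1.
  split=> [|q [/andP[q0 q1] qmax]]; first by apply: maxP; rewrite Fn lexx.
  apply/eqP; rewrite eq_le q0 leNgt /=; apply/negP => qpos.
  have := qmax 0; rewrite lexx ler01 => /(_ isT); apply/negP.
  by rewrite profile_loglik0 -ltNge profile_loglik_lt ?qpos//; lra.
Qed.
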